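(* Let $f$ and $h$ be nonzero elements of $\mathcal F$. Then for all $\alpha\in\ker(f\circ h)$ and $\beta\in\ker f^\ast\subseteq\ker(f\circ h)^\ast$, $\langle\alpha,\beta\rangle_{f\circ h}=\langle h(\alpha),\beta\rangle_f$. Similarly, for all $\alpha\in\ker f\subseteq\ker(h\circ f)$ and $\beta\in\ker(h\circ f)^\ast$, $\langle\alpha,\beta\rangle_{h\circ f}=\langle\alpha,h^\ast(\beta)\rangle_f$.
   Context: Let $p$ be a prime, $q$ a power of $p$, and $C$ an algebraically closed field containing $\mathbb F_q$, complete with respect to a non-archimedean absolute value. $\mathcal F$ is the set of formal sums $f=\sum_{n\in\mathbb Z}a_n\tau^n$ ($a_n\in C$) such that $f(z)=\sum_na_nz^{q^n}$ converges for all $z\in C$; it is a ring (without zero divisors) under termwise addition and composition $(\sum a_i\tau^i)\circ(\sum b_j\tau^j)=\sum_n(\sum_{i+j=n}a_ib_j^{q^i})\tau^n$ (composition of maps), with $c\in C$ identified with multiplication by $c$. $\ker f=\{z\in C:f(z)=0\}$. The adjoint is $f^\ast=\sum_na_n^{1/q^n}\tau^{-n}$, and $(f\circ g)^\ast=g^\ast\circ f^\ast$. For nonzero $f$ and $\alpha\in\ker f$, $g_\alpha\in\mathcal F$ is the unique element with $f\circ\alpha=g_\alpha\circ(1-\tau)$, and $\langle\alpha,\beta\rangle_f=g_\alpha^\ast(\beta)\in\mathbb F_q$ for $\beta\in\ker f^\ast$. *)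

(* Defs.v *)
From HB Require Import structures.
From mathcomp Require Import all_boot all_order all_algebra.
From mathcomp Require Import all_classical all_reals all_analysis.
Set Implicit Arguments.
Unset Strict Implicit.
Unset Printing Implicit Defensive.
Import Order.TTheory GRing.Theory Num.Theory.
Import numFieldNormedType.Exports.
Local Open Scope classical_set_scope.
Local Open Scope ring_scope.

Record nonarch_abs (R : realType) (C : fieldType) (v : C -> R) : Prop :=
  NonarchAbs {
    nonarch_abs_ge0 : forall x, 0 <= v x;
    nonarch_abs_eq0 : forall x, v x = 0 <-> x = 0;
    nonarch_absM : forall x y, v (x * y) = v x * v y;
    nonarch_absD : forall x y, v (x + y) <= Num.max (v x) (v y) }.

Definition abs_complete (R : realType) (C : fieldType) (v : C -> R) : Prop :=
  forall u : nat -> C,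
    (forall e : R, 0 < e ->
       exists N : nat, forall m n : nat,
         (N <= m)%N -> (N <= n)%N -> v (u m - u n) < e) ->
    exists l : C, v (u n - l) @[n --> \oo] --> (0 : R).

(* The formal sum \sum_n a_n tau^n is represented by n |-> a_n; the ring F
   consists of those satisfying everywhere_convergent below. *)
Definition tau_series (C : fieldType) := int -> C.

(* x ^ (q ^ n) for n in Z. For n < 0 this is the q^|n|-th root of x, which
   exists and is unique when C is an algebraically closed field of
   characteristic p and q is a power of p; it is a junk value otherwise. *)
Definition frobz (C : fieldType) (q : nat) (n : int) (x : C) : C :=
  match n with
  | Posz k => x ^+ (q ^ k)
  | Negz k => xget 0 [set y : C | y ^+ (q ^ k.+1) = x]
  end.

(* Doubly infinite series: the partial sums over [-N.2, N.1 - 1] converge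
   to s as N.1 and N.2 tend to infinity independently. *)
Definition zsum_to (R : realType) (C : fieldType) (v : C -> R)
    (u : int -> C) (s : C) : Prop :=
  v (\sum_(i < N.1) u (Posz i) + \sum_(i < N.2) u (Negz i) - s)
    @[N --> filter_prod \oo \oo] --> (0 : R).

Definition zsum (R : realType) (C : fieldType) (v : C -> R)
    (u : int -> C) : C :=
  xget 0 [set s : C | zsum_to v u s].

Section TauSeries.
Context (R : realType) (C : fieldType) (v : C -> R) (q : nat).
Implicit Types f g : tau_series C.

Definition everywhere_convergent f : Prop :=
  forall z : C, exists s : C, zsum_to v (fun n => f n * frobz q n z) s.

Definition tau_eval f (z : C) : C := zsum v (fun n => f n * frobz q n z).

Definition tau_ker f : set C := [set z | tau_eval f z = 0].

Definition tau_comp f g : tau_series C :=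
  fun n => zsum v (fun i => f i * frobz q i (g (n - i))).

Definition tau_const (c : C) : tau_series C := fun n => if n == 0 then c else 0.

Definition tau : tau_series C := fun n => if n == 1 then 1 else 0.

Definition one_sub_tau : tau_series C := fun n => tau_const 1 n - tau n.

(* The coefficient of tau^n in \sum_m a_m^(1/q^m) tau^(-m) is
   a_(-n)^(q^n). *)
Definition tau_adjoint f : tau_series C := fun n => frobz q n (f (- n)).

(* The element g_alpha with f o alpha = g_alpha o (1 - tau); it exists and is
   unique when f is everywhere convergent and alpha is in ker f. *)
Definition tau_quotient f (alpha : C) : tau_series C :=
  xget (fun=> 0) [set g | everywhere_convergent g /\
                          tau_comp f (tau_const alpha) = tau_comp g one_sub_tau].

Definition tau_pairing f (alpha beta : C) : C :=
  tau_eval (tau_adjoint (tau_quotient f alpha)) beta.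

End TauSeries.

(* Main.v *)
Require Import Defs.
From HB Require Import structures.
From mathcomp Require Import all_boot all_order all_algebra finfield ring zify.
From mathcomp Require Import finmap.
From mathcomp Require Import all_classical all_reals all_analysis.
Set Implicit Arguments.
Unset Strict Implicit.
Unset Printing Implicit Defensive.
Import Order.TTheory GRing.Theory Num.Theory.
Import numFieldNormedType.Exports.
Local Open Scope classical_set_scope.
Local Open Scope ring_scope.

(** Write [g_(f,alpha)] for the element with
    [f o alpha = g_(f,alpha) o (1 - tau)].  An element [k] of the ring is right
    divisible by [1 - tau] exactly when [k(1) = 0], the quotient being
    [k o (1 + tau + tau^2 + ...)].  As [h o alpha - h(alpha)] vanishes at [1],
    it equals [k o (1 - tau)] for some [k], whence
    [g_(f o h,alpha) = g_(f,h(alpha)) + f o k]; the adjoint of the second term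
    is [k^* o f^*], which kills [ker f^*].  On the other side
    [g_(h o f,alpha) = h o g_(f,alpha)].

    The composite [f o x] makes sense for every bounded two-sided family [x] of
    coefficients, such as that of [1 + tau + tau^2 + ...], or a constant family
    [z], for which it is [f(z)].  Its associativity is an exchange of sums; this
    is allowed because, by the ultrametric inequality and completeness, every
    family that tends to 0 is unconditionally summable. *)

Section NonarchimedeanAbsoluteValue.
Context (R : realType) (C : fieldType) (v : C -> R) (v_abs : nonarch_abs v).

Lemma nonarch_abs0 : v 0 = 0.
Proof. exact/(nonarch_abs_eq0 v_abs). Qed.

Lemma nonarch_abs_gt0 x : x != 0 -> 0 < v x.
Proof.
move=> x_neq0; rewrite lt_def (nonarch_abs_ge0 v_abs) andbT.
by apply: contra x_neq0 => /eqP/(nonarch_abs_eq0 v_abs) ->.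
Qed.

Lemma nonarch_abs1 : v 1 = 1.
Proof.
apply: (mulfI (lt0r_neq0 (nonarch_abs_gt0 (oner_neq0 C)))).
by rewrite -(nonarch_absM v_abs) !mulr1.
Qed.

Lemma nonarch_absX x n : v (x ^+ n) = v x ^+ n.
Proof.
elim: n => [|n IHn]; first by rewrite !expr0 nonarch_abs1.
by rewrite !exprS (nonarch_absM v_abs) IHn.
Qed.

Lemma nonarch_absN x : v (- x) = v x.
Proof.
apply/eqP; rewrite -(@eqrXn2 _ 2) ?(nonarch_abs_ge0 v_abs) //.
by rewrite -!nonarch_absX sqrrN.
Qed.

Lemma nonarch_abs_le_mull a x y : v x <= v y -> v (a * x) <= v (a * y).
Proof.
move=> xy; rewrite !(nonarch_absM v_abs a).
by rewrite ler_wpM2l ?(nonarch_abs_ge0 v_abs).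
Qed.

Lemma nonarch_absD_lt eps x y : v x < eps -> v y < eps -> v (x + y) < eps.
Proof.
move=> vx vy; apply: le_lt_trans (nonarch_absD v_abs x y) _.
by rewrite gt_max vx.
Qed.

Lemma nonarch_absB_lt eps x y : v x < eps -> v y < eps -> v (x - y) < eps.
Proof. by move=> vx vy; apply: nonarch_absD_lt; rewrite ?nonarch_absN. Qed.

Lemma nonarch_abs_sum_lt (I : Type) (r : seq I) (P : pred I) (u : I -> C) eps :
  0 < eps -> (forall i, P i -> v (u i) < eps) ->
  v (\sum_(i <- r | P i) u i) < eps.
Proof.
move=> eps_gt0 u_lt; apply: (big_ind (fun x => v x < eps)) => //.
  by rewrite nonarch_abs0.
by move=> x y; apply: nonarch_absD_lt.
Qed.

Lemma nonarch_abs_small_eq0 x : (forall eps, 0 < eps -> v x < eps) -> x = 0.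
Proof.
move=> x_small; apply/eqP; apply: contraT => /nonarch_abs_gt0/x_small.
by rewrite ltxx.
Qed.

End NonarchimedeanAbsoluteValue.

Section UnconditionalSums.
Context (R : realType) (C : fieldType) (v : C -> R).

Definition null_family (I : choiceType) (u : I -> C) : Prop :=
  forall eps : R, 0 < eps ->
    exists A : {fset I}, forall i, i \notin A -> v (u i) < eps.

Definition has_sum (I : choiceType) (u : I -> C) (s : C) : Prop :=
  forall eps : R, 0 < eps ->
    exists A : {fset I}, forall B : {fset I},
      (A `<=` B)%fset -> v (\sum_(i <- B) u i - s) < eps.

(* The bound is the absolute value of an element of C, so that everywhere
   convergent series may be evaluated at it. *)
Definition bounded_family (I : Type) (u : I -> C) : Prop :=
  exists c, forall i, v (u i) <= v c.

Definition continuous_at0 (phi : C -> C) : Prop :=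
  forall eps : R, 0 < eps ->
    exists2 delta, 0 < delta & forall x, v x < delta -> v (phi x) < eps.

End UnconditionalSums.

Section UltrametricSums.
Context (R : realType) (C : fieldType) (v : C -> R) (v_abs : nonarch_abs v).
Context (I J : choiceType).
Implicit Types (u w : I -> C) (A B : {fset I}).

Local Notation null_family := (null_family v).
Local Notation has_sum := (has_sum v).

Lemma null_family_le u w :
  (forall i, v (u i) <= v (w i)) -> null_family w -> null_family u.
Proof.
move=> uw w_null eps /w_null[A A_tail]; exists A => i /A_tail.
exact: le_lt_trans.
Qed.

Lemma null_familyD u w :
  null_family u -> null_family w -> null_family (u \+ w).
Proof.
move=> u_null w_null eps eps_gt0.
have [A A_tail] := u_null _ eps_gt0; have [B B_tail] := w_null _ eps_gt0.
exists (A `|` B)%fset => i; rewrite inE negb_or => /andP[/A_tail ? /B_tail ?].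
exact: nonarch_absD_lt.
Qed.

Lemma null_family_continuous (phi : C -> C) u :
  continuous_at0 v phi -> null_family u -> null_family (phi \o u).
Proof.
move=> phi_cont u_null eps /phi_cont[delta delta_gt0 phi_lt].
by have [A A_tail] := u_null _ delta_gt0; exists A => i /A_tail/phi_lt.
Qed.

Lemma continuous_at0_mull a : continuous_at0 v (a \*o idfun).
Proof.
move=> eps eps_gt0; have [->|a_neq0] := eqVneq a 0.
  by exists 1 => // x _; rewrite /= mul0r nonarch_abs0.
have va_gt0 := nonarch_abs_gt0 v_abs a_neq0.
exists (eps / v a) => [|x]; first exact: divr_gt0.
by rewrite /= (nonarch_absM v_abs) ltr_pdivlMr // mulrC.
Qed.

Lemma null_familyZ a u : null_family u -> null_family (fun i => a * u i).
Proof. exact: null_family_continuous (continuous_at0_mull a). Qed.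

Lemma null_family_supp A u : (forall i, i \notin A -> u i = 0) -> null_family u.
Proof.
by move=> A_supp eps eps_gt0; exists A => i /A_supp ->; rewrite nonarch_abs0.
Qed.

Lemma null_family_bounded u : null_family u -> bounded_family v u.
Proof.
move=> /(_ 1 ltr01)[A A_tail].
suff [c c_ge1 c_bound] : exists2 c, 1 <= v c &
    {in enum_fset A, forall i, v (u i) <= v c}.
  exists c => i; have [/c_bound //|/A_tail/ltW u_le1] := boolP (i \in A).
  exact: le_trans c_ge1.
elim: (enum_fset A) => [|i r [c c_ge1 c_bound]].
  by exists 1; rewrite ?nonarch_abs1.
have [ui_le|/ltW c_le] := leP (v (u i)) (v c).
  by exists c => // j; rewrite inE => /predU1P[->|/c_bound].
exists (u i); first exact: le_trans c_le.
move=> j; rewrite inE => /predU1P[->//|/c_bound] /le_trans; exact.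
Qed.

Lemma null_family_pair (u : I -> J -> C) (t : I -> C) :
  (forall i, null_family (u i)) -> null_family t ->
  (forall i j, v (u i j) <= v (t i)) ->
  null_family (fun p : I * J => u p.1 p.2).
Proof.
move=> u_null t_null ut eps eps_gt0; have [A A_tail] := t_null _ eps_gt0.
have [B B_tail] := choice (fun i => u_null i _ eps_gt0).
exists [fset ((i, j) : I * J) | i in A, j in B i]%fset => -[i j] /= ij_notin.
have [iA|/A_tail] := boolP (i \in A); last exact: le_lt_trans.
apply: B_tail; apply: contra ij_notin => jB; apply/imfset2P.
by exists i; last exists j.
Qed.

Lemma sum_fset_sub_lt u A B eps :
  0 < eps -> (forall i, i \notin A -> v (u i) < eps) ->
  (forall i, i \notin B -> v (u i) < eps) ->
  v (\sum_(i <- A) u i - \sum_(i <- B) u i) < eps.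
Proof.
move=> eps_gt0 A_tail B_tail.
rewrite (big_fsetIDcond _ (mem B)) [X in _ - X](big_fsetIDcond _ (mem A)) /=.
have -> : [fset i in B | i \in A]%fset = [fset i in A | i \in B]%fset.
  by apply/fsetP => i; rewrite !inE andbC.
rewrite opprD addrACA subrr add0r !big_fset /=.
by apply: nonarch_absB_lt => //; apply: nonarch_abs_sum_lt.
Qed.

Lemma has_sum_unique u s t : has_sum u s -> has_sum u t -> s = t.
Proof.
move=> us ut; apply/eqP; rewrite -subr_eq0; apply/eqP.
apply: (nonarch_abs_small_eq0 v_abs) => eps eps_gt0.
have [A A_lt] := us _ eps_gt0; have [B B_lt] := ut _ eps_gt0.
have := nonarch_absB_lt v_abs (B_lt _ (fsubsetUr A B)) (A_lt _ (fsubsetUl A B)).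
by rewrite opprB addrC addrA subrK.
Qed.

Lemma has_sum_null u s : has_sum u s -> null_family u.
Proof.
move=> us eps /us[A A_lt]; exists A => i iA.
have -> : u i = \sum_(j <- (i |` A)%fset) u j - s - (\sum_(j <- A) u j - s).
  by rewrite big_fsetU1 //=; ring.
by apply: nonarch_absB_lt => //; apply: A_lt; rewrite ?fsubset_refl ?fsubsetUr.
Qed.

Lemma has_sum_lt u s eps :
  has_sum u s -> 0 < eps -> (forall i, v (u i) < eps) -> v s < eps.
Proof.
move=> us eps_gt0 u_lt; have [A /(_ A (fsubset_refl A)) A_lt] := us _ eps_gt0.
rewrite -[s](subKr (\sum_(i <- A) u i)); apply: nonarch_absB_lt => //.
exact: nonarch_abs_sum_lt.
Qed.

Lemma has_sum_supp A u :
  (forall i, i \notin A -> u i = 0) -> has_sum u (\sum_(i <- A) u i).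
Proof.
move=> A_supp eps eps_gt0; exists A => B AB.
by rewrite (big_fset_incl _ AB) ?subrr ?nonarch_abs0 // => i _; apply: A_supp.
Qed.

Lemma has_sumD u w s t :
  has_sum u s -> has_sum w t -> has_sum (u \+ w) (s + t).
Proof.
move=> us wt eps eps_gt0.
have [A A_lt] := us _ eps_gt0; have [B B_lt] := wt _ eps_gt0.
exists (A `|` B)%fset => D /fsubUsetP[/A_lt ? /B_lt ?].
by rewrite big_split opprD addrACA; apply: nonarch_absD_lt.
Qed.

Lemma has_sum_raddf (phi : {additive C -> C}) u s :
  continuous_at0 v phi -> has_sum u s -> has_sum (phi \o u) (phi s).
Proof.
move=> phi_cont us eps /phi_cont[delta delta_gt0 phi_lt].
have [A A_lt] := us _ delta_gt0; exists A => B /A_lt/phi_lt.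
by rewrite raddfB raddf_sum.
Qed.

Lemma has_sumZ a u s : has_sum u s -> has_sum (fun i => a * u i) (a * s).
Proof. exact: has_sum_raddf (continuous_at0_mull a). Qed.

Lemma has_sum_reindex (k : J -> I) u s :
  bijective k -> has_sum u s -> has_sum (u \o k) s.
Proof.
move=> [k' kK k'K] us eps /us[A A_lt].
exists (k' @` A)%fset => B AB; have := A_lt (k @` B)%fset.
rewrite big_imfset /= => [|i j _ _ /(can_inj kK)//]; apply.
apply/fsubsetP => i iA; apply/imfsetP; exists (k' i); rewrite /= ?k'K //.
by apply: (fsubsetP AB); apply: in_imfset.
Qed.

Lemma has_sum_pair (u : I -> J -> C) (t : I -> C) s :
  has_sum (fun p : I * J => u p.1 p.2) s -> (forall i, has_sum (u i) (t i)) ->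
  has_sum t s.
Proof.
move=> us ut eps eps_gt0; have [A A_lt] := us _ eps_gt0.
have [B B_lt] := choice (fun i => ut i _ eps_gt0).
exists [fset p.1 | p in A]%fset => I0 AI0.
pose J0 i := (B i `|` [fset p.2 | p in A])%fset.
have A_sub : (A `<=` [fset ((i, j) : I * J) | i in I0, j in J0 i])%fset.
  apply/fsubsetP => p pA; apply/imfset2P; exists p.1.
    by apply: (fsubsetP AI0); apply: in_imfset.
  exists p.2; last by case: p {pA}.
  by rewrite inE; apply/orP; right; apply: in_imfset.
have := A_lt _ A_sub; rewrite big_imfset2 /= => [A_s|]; last first.
  by move=> [i j] [i' j'] _ _ /= [-> ->].
rewrite -(subrK (\sum_(i <- I0) \sum_(j <- J0 i) u i j) (\sum_(i <- I0) t i)).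
rewrite -addrA; apply: nonarch_absD_lt => //.
rewrite -sumrB; apply: nonarch_abs_sum_lt => // i _.
by rewrite -(nonarch_absN v_abs) opprB; apply: B_lt; apply: fsubsetUl.
Qed.

Lemma null_family_summable u :
  abs_complete v -> null_family u -> exists s, has_sum u s.
Proof.
move=> v_complete u_null.
have inv_gt0 (n : nat) : 0 < n.+1%:R^-1 :> R by rewrite invr_gt0.
have [A A_tail] := choice (fun n => u_null _ (inv_gt0 n)).
have inv_lt (eps : R) : 0 < eps ->
    exists N : nat, forall n, (N <= n)%N -> n.+1%:R^-1 < eps.
  move=> eps_gt0; have [N _ N_lt] := near_infty_natSinv_lt (PosNum eps_gt0).
  by exists N => n /N_lt.
have tail_lt n (eps : R) i : n.+1%:R^-1 < eps -> i \notin A n -> v (u i) < eps.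
  by move=> n_lt /A_tail/lt_trans; apply.
have [|s A_s] := v_complete (fun n => \sum_(i <- A n) u i).
  move=> eps eps_gt0; have [N N_lt] := inv_lt _ eps_gt0.
  exists N => m n /N_lt m_lt /N_lt n_lt.
  by apply: sum_fset_sub_lt => // i; apply: tail_lt.
exists s => eps eps_gt0; have [N N_lt] := inv_lt _ eps_gt0.
have [M _ M_lt] := (iffLR (cvgr0Pnorm_lt _)) A_s _ eps_gt0.
set n := maxn N M; exists (A n) => B /fsubsetP AB.
rewrite -(subrK (\sum_(i <- A n) u i) (\sum_(i <- B) u i)) -addrA.
have n_lt := N_lt n (leq_maxl _ _); apply: nonarch_absD_lt => //.
  apply: sum_fset_sub_lt => // i iB; apply: tail_lt n_lt _ => //.
  by apply: contra iB; apply: AB.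
by apply: le_lt_trans (ler_norm _) _; apply: M_lt; apply: leq_maxr.
Qed.

End UltrametricSums.

Section DoublyInfiniteSums.
Context (R : realType) (C : fieldType) (v : C -> R) (v_abs : nonarch_abs v).
Implicit Types u : int -> C.

Definition int_box (m n : nat) : {fset int} :=
  seq_fset tt (map Posz (iota 0 m) ++ map Negz (iota 0 n)).

Lemma mem_int_box m n i : (i \in int_box m n) = (- n%:Z <= i < m%:Z).
Proof.
rewrite seq_fsetE mem_cat; case: i => i.
  rewrite mem_map ?mem_iota => [|? ? []//].
  suff /negPf -> : Posz i \notin map Negz (iota 0 n) by lia.
  by apply/mapP => -[].
rewrite orbC mem_map ?mem_iota => [|? ? []//].
suff /negPf -> : Negz i \notin map Posz (iota 0 m) by lia.
by apply/mapP => -[].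
Qed.

Lemma big_int_box m n u :
  \sum_(i <- int_box m n) u i =
  \sum_(i < m) u (Posz i) + \sum_(i < n) u (Negz i).
Proof.
have box_uniq : uniq (map Posz (iota 0 m) ++ map Negz (iota 0 n)).
  rewrite cat_uniq !map_inj_uniq ?iota_uniq ?andbT /= => [|? ? []//|? ? []//].
  by apply/hasPn => _ /mapP[i _ ->]; apply/mapP => -[].
rewrite (perm_big _ (seq_fset_perm _ _)) undup_id // big_cat !big_map.
by rewrite -!(big_mkord xpredT (u \o _)) /index_iota !subn0.
Qed.

Lemma int_box_exhaust (A : {fset int}) :
  exists N : nat, forall m n,
    (N <= m)%N -> (N <= n)%N -> (A `<=` int_box m n)%fset.
Proof.
exists (\max_(i <- A) `|i|.+1)%N => m n Nm Nn; apply/fsubsetP => i iA.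
have i_lt : (`|i| < \max_(i <- A) `|i|.+1)%N.
  exact: (leq_bigmax_seq (F := fun j : int => `|j|.+1)%N).
by rewrite mem_int_box; lia.
Qed.

Lemma zsum_to_boxP u s :
  zsum_to v u s <-> forall eps, 0 < eps -> exists N : nat, forall m n,
    (N <= m)%N -> (N <= n)%N -> v (\sum_(i <- int_box m n) u i - s) < eps.
Proof.
split=> [us eps eps_gt0|us].
  have /= [[P Q] [/= [M _ MP] [N _ NQ]] PQ] :=
    (iffLR (cvgr0Pnorm_lt _)) us _ eps_gt0.
  exists (maxn M N) => m n; rewrite !geq_max => /andP[Mm _] /andP[_ Nn].
  rewrite big_int_box; apply: le_lt_trans (ler_norm _) _; apply: (PQ (m, n)).
  by split; [apply: MP|apply: NQ].
apply/cvgr0Pnorm_lt => eps /us[N N_lt].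
exists ([set n | (N <= n)%N], [set n | (N <= n)%N]).
  by split; apply: nbhs_infty_ge.
move=> [m n] [/= Nm Nn]; rewrite ger0_norm ?(nonarch_abs_ge0 v_abs) //.
by rewrite -big_int_box; apply: N_lt.
Qed.

Lemma zsum_toP u s : zsum_to v u s <-> has_sum v u s.
Proof.
split=> [/zsum_to_boxP us eps eps_gt0|us]; last first.
  apply/zsum_to_boxP => eps /us[A A_lt]; have [N N_sub] := int_box_exhaust A.
  by exists N => m n Nm Nn; apply: A_lt; apply: N_sub.
have [N N_lt] := us _ eps_gt0.
have box_tail i : i \notin int_box N N -> v (u i) < eps.
  rewrite mem_int_box; case: i => i i_out.
    have -> : u (Posz i) = \sum_(j <- int_box i.+1 N) u j - s
                           - (\sum_(j <- int_box i N) u j - s).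
      by rewrite !big_int_box big_ord_recr /=; ring.
    by apply: nonarch_absB_lt => //; apply: N_lt; lia.
  have -> : u (Negz i) = \sum_(j <- int_box N i.+1) u j - s
                         - (\sum_(j <- int_box N i) u j - s).
    by rewrite !big_int_box big_ord_recr /=; ring.
  by apply: nonarch_absB_lt => //; apply: N_lt; lia.
exists (int_box N N) => B /fsubsetP NB.
rewrite -(subrK (\sum_(i <- int_box N N) u i) (\sum_(i <- B) u i)) -addrA.
apply: nonarch_absD_lt (N_lt _ _ _ _) => //; apply: sum_fset_sub_lt => // i iB.
by apply: box_tail; apply: contra iB; apply: NB.
Qed.

Lemma zsum_eq u s : has_sum v u s -> zsum v u = s.
Proof.
move=> us; apply: xget_unique; first exact/zsum_toP.
by move=> t /zsum_toP ut; apply: has_sum_unique ut us.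
Qed.

End DoublyInfiniteSums.

Section PerfectField.
Context (C : fieldType) (q : nat) (q_pchar : [pchar C].-nat q).
Hypothesis q_root : forall x : C, exists y, y ^+ q = x.

Local Notation phi := (@frobz C q).

Let qX_pchar n : [pchar C].-nat (q ^ n)%N.
Proof. by rewrite pnatX q_pchar. Qed.

Let qX_gt0 n : (0 < q ^ n)%N.
Proof. by rewrite expn_gt0; case/andP: q_pchar => ->. Qed.

Lemma exp_qX_inj n : injective (fun x : C => x ^+ (q ^ n)).
Proof.
move=> x y /= xy; apply/eqP; rewrite -subr_eq0.
have /eqP : (x - y) ^+ (q ^ n) = 0.
  by apply: (addIr (y ^+ (q ^ n))); rewrite -exprDn_pchar // subrK xy add0r.
by rewrite expf_eq0 => /andP[].
Qed.

Lemma exp_qX_surj n (x : C) : exists y, y ^+ (q ^ n) = x.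
Proof.
elim: n x => [|n IHn] x; first by exists x; rewrite expr1.
have [z <-] := q_root x; have [y <-] := IHn z.
by exists y; rewrite expnSr exprM.
Qed.

Lemma frobz_exp n N x :
  0 <= n + N%:Z -> phi n x ^+ (q ^ N) = x ^+ (q ^ `|n + N%:Z|).
Proof.
case: n => k; first by move=> _; rewrite /= -exprM -expnD.
move=> kN; have [d ->] : exists d, N = (k.+1 + d)%N by exists (N - k.+1)%N; lia.
have frobzK : phi (Negz k) x ^+ (q ^ k.+1) = x.
  rewrite /frobz; case: xgetP => [y _ //|no_root].
  by have [y /no_root] := exp_qX_surj k.+1 x.
by rewrite expnD exprM frobzK; congr (_ ^+ (q ^ _)); lia.
Qed.

Lemma frobz_exp_abs n x : phi n x ^+ (q ^ `|n|) = x ^+ (q ^ `|n + `|n|%:Z|).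
Proof. by rewrite frobz_exp //; lia. Qed.

Lemma frobz_id x : phi 0 x = x.
Proof. by rewrite /= expn0 expr1. Qed.

Lemma frobz_comp m n x : phi m (phi n x) = phi (m + n) x.
Proof.
apply: (@exp_qX_inj (`|m| + `|n|)%N); rewrite [RHS]frobz_exp; last lia.
rewrite expnD exprM frobz_exp_abs exprAC frobz_exp_abs -exprM -expnD.
by congr (_ ^+ (q ^ _)); lia.
Qed.

Lemma frobz_is_nmod_morphism n : nmod_morphism (phi n).
Proof.
split=> [|x y]; apply: (@exp_qX_inj `|n|%N); rewrite frobz_exp_abs.
  by rewrite !expr0n !gtn_eqF.
by rewrite !exprDn_pchar // !frobz_exp_abs.
Qed.

Lemma frobz_is_monoid_morphism n : monoid_morphism (phi n).
Proof.
split=> [|x y]; apply: (@exp_qX_inj `|n|%N); rewrite frobz_exp_abs.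
  by rewrite !expr1n.
by rewrite !exprMn !frobz_exp_abs.
Qed.

HB.instance Definition _ n :=
  GRing.isNmodMorphism.Build C C (frobz q n) (frobz_is_nmod_morphism n).
HB.instance Definition _ n :=
  GRing.isMonoidMorphism.Build C C (frobz q n) (frobz_is_monoid_morphism n).

Section AbsoluteValue.
Context (R : realType) (v : C -> R) (v_abs : nonarch_abs v).

Lemma frobz_abs_exp n x :
  v (phi n x) ^+ (q ^ `|n|) = v x ^+ (q ^ `|n + `|n|%:Z|).
Proof. by rewrite -!(nonarch_absX v_abs) frobz_exp_abs. Qed.

Let v_nneg x : v x \is Num.nneg.
Proof. exact: nonarch_abs_ge0. Qed.

Lemma frobz_abs_le n x y : (v (phi n x) <= v (phi n y)) = (v x <= v y).
Proof. by rewrite -(ler_pXn2r (qX_gt0 `|n|)) // !frobz_abs_exp ler_pXn2r. Qed.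

Lemma frobz_abs_lt1 n x : (v (phi n x) < 1) = (v x < 1).
Proof.
by rewrite -(nonarch_abs1 v_abs) -{1}(rmorph1 (phi n)) !ltNge frobz_abs_le.
Qed.

Lemma frobz_abs_le_homo m n z c : v z <= v c -> 1 <= v c -> m <= n ->
  v (phi m z) <= v (phi n c).
Proof.
move=> zc c_ge1 mn; rewrite -[n](subrK m) addrC -frobz_comp frobz_abs_le.
have [k ->] : exists k, n - m = Posz k by exists `|n - m|%N; lia.
apply: le_trans zc _.
by rewrite /= (nonarch_absX v_abs) ler_eXnr.
Qed.

Lemma frobz_continuous n : continuous_at0 v (phi n).
Proof.
move=> eps eps_gt0; exists (Num.min 1 (eps ^+ (q ^ `|n|))).
  by rewrite lt_min ltr01 exprn_gt0.
move=> x; rewrite lt_min => /andP[x_lt1 x_lt].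
rewrite -(ltr_pXn2r (qX_gt0 `|n|)) ?frobz_abs_exp //; last exact: ltW.
apply: le_lt_trans x_lt; rewrite -[leRHS]expr1.
by apply: ler_wiXn2l; rewrite ?(nonarch_abs_ge0 v_abs) // ltW.
Qed.

Lemma null_family_frobz (I : choiceType) (u : I -> C) n :
  null_family v u -> null_family v (fun i => phi n (u i)).
Proof. exact: null_family_continuous (frobz_continuous n). Qed.

Lemma has_sum_frobz (I : choiceType) (u : I -> C) s n :
  has_sum v u s -> has_sum v (fun i => phi n (u i)) (phi n s).
Proof. exact: (has_sum_raddf (phi := phi n) (frobz_continuous n)). Qed.

Section CompleteField.
Context (v_complete : abs_complete v).
Implicit Types (f g h k : tau_series C) (x : int -> C).

Local Notation conv := (everywhere_convergent v q).
Local Notation eval := (tau_eval v q).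
Local Notation ker := (tau_ker v q).
Local Notation adj := (tau_adjoint q).
Local Notation "f \oT g" := (tau_comp v q f g)
  (at level 40, left associativity).

Lemma everywhere_convergentP f :
  conv f <-> forall z, null_family v (fun n => f n * phi n z).
Proof.
split=> f_conv z.
  have [s /(zsum_toP v_abs) fs] := f_conv z.
  exact: has_sum_null fs.
have [s fs] := null_family_summable v_abs v_complete (f_conv z).
by exists s; apply/zsum_toP.
Qed.

Lemma everywhere_convergent_null f : conv f -> null_family v f.
Proof.
move=> /everywhere_convergentP/(_ 1); apply: null_family_le => n.
by rewrite rmorph1 mulr1.
Qed.

Lemma everywhere_convergent_bounded f : conv f -> bounded_family v f.
Proof. by move=> /everywhere_convergent_null/(null_family_bounded v_abs). Qed.

Lemma everywhere_convergent_supp (A : {fset int}) f :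
  (forall n, n \notin A -> f n = 0) -> conv f.
Proof.
move=> A_supp; apply/everywhere_convergentP => z.
by apply: null_family_supp => // n /A_supp ->; rewrite mul0r.
Qed.

Lemma everywhere_convergentD f g : conv f -> conv g -> conv (f \+ g).
Proof.
move=> /everywhere_convergentP f_conv /everywhere_convergentP g_conv.
apply/everywhere_convergentP => z; under eq_fun do rewrite mulrDl.
exact: null_familyD.
Qed.

Lemma tau_comp_has_sum f x n : conv f -> bounded_family v x ->
  has_sum v (fun i => f i * phi i (x (n - i))) ((f \oT x) n).
Proof.
move=> /everywhere_convergentP f_conv [c x_le].
pose u i := f i * phi i (x (n - i)).
have [|s fxs] := null_family_summable (u := u) v_abs v_complete.
  apply: null_family_le (f_conv c) => i; apply: nonarch_abs_le_mull => //.
  by rewrite frobz_abs_le.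
by rewrite /tau_comp (zsum_eq v_abs fxs).
Qed.

Lemma tau_comp_eq f x n s :
  has_sum v (fun i => f i * phi i (x (n - i))) s -> (f \oT x) n = s.
Proof. exact: zsum_eq. Qed.

Lemma null_family_tau_comp f g c : conv f -> conv g ->
  null_family v (fun p : int * int => f p.1 * phi p.1 (g p.2 * phi p.2 c)).
Proof.
move=> /everywhere_convergentP f_conv /everywhere_convergentP/(_ c) gc_null.
have [b b_bound] := null_family_bounded v_abs gc_null.
pose u i j := f i * phi i (g j * phi j c).
apply: (null_family_pair (u := u) _ (f_conv b)).
  by move=> i; apply/(null_familyZ v_abs)/null_family_frobz.
by move=> i j; apply: nonarch_abs_le_mull => //; rewrite frobz_abs_le.
Qed.

Lemma tau_comp_double_sum f g x n : conv f -> conv g -> bounded_family v x ->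
  exists2 s, has_sum v (fun i => f i * phi i ((g \oT x) (n - i))) s
           & has_sum v (fun m => (f \oT g) m * phi m (x (n - m))) s.
Proof.
move=> f_conv g_conv x_bounded; have [c x_le] := x_bounded.
pose u i j := f i * phi i (g j * phi j (x (n - i - j))).
have [|s us] := null_family_summable (u := fun p => u p.1 p.2) v_abs v_complete.
  apply: null_family_le (null_family_tau_comp c f_conv g_conv) => -[i j].
  apply: nonarch_abs_le_mull => //; rewrite frobz_abs_le.
  by apply: nonarch_abs_le_mull => //; rewrite frobz_abs_le.
exists s; first apply: (has_sum_pair v_abs us) => i.
  exact/(has_sumZ v_abs)/has_sum_frobz/tau_comp_has_sum.
pose w m i := f i * phi i (g (m - i)) * phi m (x (n - m)).
pose shear (p : int * int) := (p.2, p.1 - p.2).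
have shear_bij : bijective shear.
  exists (fun p => (p.1 + p.2, p.1)) => -[i j]; rewrite /shear /=.
    by rewrite addrC subrK.
  by rewrite addrAC subrr add0r.
apply: (has_sum_pair v_abs (u := w)) => [|m].
  have := has_sum_reindex shear_bij us; congr (has_sum v _ _).
  apply/funext => -[m i]; rewrite /u /w /= rmorphM /= frobz_comp mulrA.
  have -> : n - i - (m - i) = n - m by ring.
  by rewrite (addrC i) subrK.
have g_bounded := everywhere_convergent_bounded g_conv.
have fg_sum := tau_comp_has_sum m f_conv g_bounded.
have := has_sumZ v_abs (phi m (x (n - m))) fg_sum; rewrite mulrC.
by congr (has_sum v _ _); apply/funext => i; rewrite mulrC.
Qed.

Lemma tau_compA f g x : conv f -> conv g -> bounded_family v x ->
  f \oT (g \oT x) = f \oT g \oT x.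
Proof.
move=> f_conv g_conv x_bounded; apply/funext => n.
have [s fgx_s fg_x_s] := tau_comp_double_sum n f_conv g_conv x_bounded.
by rewrite (tau_comp_eq fgx_s) (tau_comp_eq fg_x_s).
Qed.

Lemma tau_comp_convergent f g : conv f -> conv g -> conv (f \oT g).
Proof.
move=> f_conv g_conv z.
have [|s _ fg_s] := tau_comp_double_sum (x := cst z) 0 f_conv g_conv.
  by exists z.
by exists s; apply/zsum_toP.
Qed.

Lemma tau_compDr f x y :
  conv f -> bounded_family v x -> bounded_family v y ->
  f \oT (x \+ y) = f \oT x \+ f \oT y.
Proof.
move=> f_conv x_bounded y_bounded; apply/funext => n; apply: tau_comp_eq.
have := has_sumD v_abs (tau_comp_has_sum n f_conv x_bounded)
  (tau_comp_has_sum n f_conv y_bounded).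
by congr (has_sum v _ _); apply/funext => i /=; rewrite rmorphD mulrDr.
Qed.

Lemma tau_compDl f g x :
  conv f -> conv g -> bounded_family v x ->
  (f \+ g) \oT x = f \oT x \+ g \oT x.
Proof.
move=> f_conv g_conv x_bounded; apply/funext => n; apply: tau_comp_eq.
have := has_sumD v_abs (tau_comp_has_sum n f_conv x_bounded)
  (tau_comp_has_sum n g_conv x_bounded).
by congr (has_sum v _ _); apply/funext => i /=; rewrite mulrDl.
Qed.

Lemma bounded_cst z : bounded_family v (cst z : int -> C).
Proof. by exists z. Qed.

Lemma tau_comp_cst f z : f \oT cst z = cst (eval f z).
Proof. by []. Qed.

Lemma tau_eval_comp f g z : conv f -> conv g ->
  eval (f \oT g) z = eval f (eval g z).
Proof.
move=> f_conv g_conv.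
have := tau_compA f_conv g_conv (bounded_cst z); rewrite !tau_comp_cst.
by move=> /(congr1 (@^~ 0)).
Qed.

Lemma tau_evalD f g z : conv f -> conv g ->
  eval (f \+ g) z = eval f z + eval g z.
Proof.
move=> f_conv g_conv.
have := tau_compDl f_conv g_conv (bounded_cst z); rewrite !tau_comp_cst.
by move=> /(congr1 (@^~ 0)).
Qed.

Lemma tau_eval0 f : eval f 0 = 0.
Proof.
rewrite -[RHS](big_seq_fset0 +%R (fun n => f n * phi n 0)).
by apply/zsum_eq/has_sum_supp => // n _; rewrite rmorph0 mulr0.
Qed.

Lemma tau_ker_comp f g : conv f -> conv g -> ker (f \oT g) = eval g @^-1` ker f.
Proof.
move=> f_conv g_conv; apply/seteqP.
by split=> z; rewrite /tau_ker /= tau_eval_comp.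
Qed.

Lemma tau_ker_comp_sub f g : conv f -> conv g -> ker g `<=` ker (f \oT g).
Proof.
move=> f_conv g_conv z gz0.
by rewrite tau_ker_comp // /tau_ker /= gz0 tau_eval0.
Qed.

Lemma tau_adjoint_comp f g : conv f -> conv g ->
  adj (f \oT g) = adj g \oT adj f.
Proof.
move=> f_conv g_conv; apply/funext => n; apply/esym/tau_comp_eq.
have g_bounded := everywhere_convergent_bounded g_conv.
have shift_bij : bijective (fun j : int => j - n).
  by exists (+%R^~ n); [exact: subrK|exact: addrK].
have := has_sum_frobz n (tau_comp_has_sum (- n) f_conv g_bounded).
move=> /(has_sum_reindex shift_bij); congr (has_sum v _ _); apply/funext => j.
rewrite /tau_adjoint /= !rmorphM /= !frobz_comp mulrC.
by congr (phi _ (g _) * phi _ (f _)); ring.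
Qed.

Lemma tau_adjointD f g : adj (f \+ g) = adj f \+ adj g.
Proof. by apply/funext => n; rewrite /tau_adjoint /= rmorphD. Qed.

(* The terms of the adjoint at z are the q^n-th roots of the f_n z, and f_n z
   becomes smaller than c^(q^n) for every nonzero c.  When no nonzero element of
   C has absolute value at most eps, f_n z is eventually 0. *)
Lemma tau_adjoint_convergent f : conv f -> conv (adj f).
Proof.
move=> f_conv; apply/everywhere_convergentP => z eps eps_gt0.
suff [A A_tail] : exists A : {fset int}, forall n, n \notin A ->
    v (phi (- n) (f n * z)) < eps.
  exists (-%R @` A)%fset => n n_notin; rewrite /tau_adjoint -rmorphM /=.
  rewrite -{1}[n]opprK; apply: A_tail; apply: contra n_notin => nA.
  by rewrite -[n]opprK; apply: in_imfset.
have [[c c_neq0 c_le]|no_c] := pselect (exists2 c, c != 0 & v c <= eps).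
  move: f_conv => /everywhere_convergentP/(_ c^-1)/(null_familyZ v_abs z).
  move=> /(_ 1 ltr01)[A A_tail]; exists A => n /A_tail.
  rewrite -(frobz_abs_lt1 (- n)) mulrCA mulrA rmorphM /= frobz_comp addNr.
  rewrite frobz_id => fz_lt; apply: lt_le_trans c_le.
  rewrite -[X in v X](mulfVK c_neq0) (nonarch_absM v_abs).
  by rewrite gtr_pMl // nonarch_abs_gt0.
have := null_familyZ v_abs z (everywhere_convergent_null f_conv).
move=> /(_ eps eps_gt0)[A A_tail]; exists A => n /A_tail; rewrite mulrC.
have [->|fz_neq0 fz_lt] := eqVneq (f n * z) 0.
  by rewrite rmorph0 nonarch_abs0.
by case: no_c; exists (f n * z) => //; apply: ltW.
Qed.

Lemma tau_ker_adjoint_comp_sub f g : conv f -> conv g ->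
  ker (adj f) `<=` ker (adj (f \oT g)).
Proof.
move=> f_conv g_conv; rewrite tau_adjoint_comp //.
by apply: tau_ker_comp_sub; apply: tau_adjoint_convergent.
Qed.

Lemma tau_const_convergent a : conv (tau_const a).
Proof.
apply: (@everywhere_convergent_supp [fset 0]%fset) => n.
by rewrite inE /tau_const => /negPf ->.
Qed.

Lemma one_sub_tau_convergent : conv (one_sub_tau C).
Proof.
apply: (@everywhere_convergent_supp [fset 0; 1]%fset) => n.
rewrite !inE negb_or /one_sub_tau /tau_const /tau.
by move=> /andP[/negPf -> /negPf ->]; rewrite subrr.
Qed.

Lemma tau_const_bounded a : bounded_family v (tau_const a).
Proof. exact/everywhere_convergent_bounded/tau_const_convergent. Qed.

Lemma one_sub_tau_bounded : bounded_family v (one_sub_tau C).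
Proof. exact/everywhere_convergent_bounded/one_sub_tau_convergent. Qed.

Local Hint Resolve tau_const_convergent one_sub_tau_convergent : core.
Local Hint Resolve tau_const_bounded one_sub_tau_bounded : core.

Lemma tau_eval_const a z : eval (tau_const a) z = a * z.
Proof.
rewrite -[X in a * X]frobz_id.
rewrite -[RHS](big_seq_fset1 +%R 0 (fun n => tau_const a n * phi n z)).
apply/zsum_eq/has_sum_supp => // n.
by rewrite inE /tau_const => /negPf ->; rewrite mul0r.
Qed.

Lemma tau_comp_const f a n : (f \oT tau_const a) n = f n * phi n a.
Proof.
pose u i := f i * phi i (tau_const a (n - i)).
have -> : f n * phi n a = \sum_(i <- [fset n]%fset) u i.
  by rewrite big_seq_fset1 /u /tau_const subrr.
apply/tau_comp_eq/has_sum_supp => // i; rewrite inE => i_neq.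
by rewrite /tau_const subr_eq0 eq_sym (negPf i_neq) rmorph0 mulr0.
Qed.

Lemma tau_comp_one_sub_tau x n : (x \oT one_sub_tau C) n = x n - x (n - 1).
Proof.
pose u i := x i * phi i (one_sub_tau C (n - i)).
have -> : x n - x (n - 1) = \sum_(i <- [fset n; n - 1]%fset) u i.
  rewrite big_fsetU1 ?big_seq_fset1 ?inE /=; last lia.
  rewrite /u /one_sub_tau /tau_const /tau.
  by rewrite subrr subKr /= subr0 sub0r rmorphN !rmorph1 mulr1 mulrN1.
apply/tau_comp_eq/has_sum_supp => // i; rewrite !inE negb_or.
move=> /andP[i_neq i_neq1]; rewrite /one_sub_tau /tau_const /tau.
by rewrite ifF ?ifF ?subr0 ?rmorph0 ?mulr0 //; lia.
Qed.

Lemma one_sub_tau_comp x n : (one_sub_tau C \oT x) n = x n - phi 1 (x (n - 1)).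
Proof.
pose u i := one_sub_tau C i * phi i (x (n - i)).
have -> : x n - phi 1 (x (n - 1)) = \sum_(i <- [fset 0; 1]%fset) u i.
  rewrite big_fsetU1 ?big_seq_fset1 ?inE // /u subr0 frobz_id.
  by rewrite /one_sub_tau /tau_const /tau /= subr0 sub0r mul1r mulN1r.
apply/tau_comp_eq/has_sum_supp => // i; rewrite !inE negb_or.
move=> /andP[i_neq0 i_neq1].
by rewrite /one_sub_tau /tau_const /tau !ifN // subr0 mul0r.
Qed.

Definition tau_indic (P : pred int) : tau_series C := fun n => (P n)%:R.

(* The inverse of 1 - tau among the Laurent series in tau. *)
Definition tau_geom : tau_series C := tau_indic (fun n => 0 <= n).

Lemma tau_indic_bounded P : bounded_family v (tau_indic P).
Proof.
exists 1 => n; rewrite /tau_indic.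
by case: (P n); rewrite ?(nonarch_abs0 v_abs) ?(nonarch_abs_ge0 v_abs).
Qed.

Lemma tau_geom_bounded : bounded_family v tau_geom.
Proof. exact: tau_indic_bounded. Qed.

Local Hint Resolve tau_indic_bounded tau_geom_bounded : core.

Lemma tau_comp_indic_lt f (P : pred int) n a eps : conv f -> 0 < eps ->
  (forall i, P (n - i) -> v (f i * a) < eps) ->
  v ((f \oT tau_indic P) n * a) < eps.
Proof.
move=> f_conv eps_gt0 fa_lt; rewrite mulrC.
have fP := has_sumZ v_abs a (tau_comp_has_sum n f_conv (tau_indic_bounded P)).
apply: (has_sum_lt v_abs fP eps_gt0) => i; rewrite /tau_indic rmorph_nat.
case: (P (n - i)) (fa_lt i) => [/(_ isT)|_]; first by rewrite mulr1 mulrC.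
by rewrite !mulr0 (nonarch_abs0 v_abs).
Qed.

Lemma tau_geom_sub n : tau_geom n - tau_geom (n - 1) = tau_const 1 n.
Proof.
rewrite /tau_geom /tau_indic /tau_const; have [->|n_neq0] := eqVneq n 0.
  by rewrite sub0r /= subr0.
have -> : (0 <= n - 1) = (0 <= n) by lia.
exact: subrr.
Qed.

Lemma tau_comp_const1 f : f \oT tau_const 1 = f.
Proof. by apply/funext => n; rewrite tau_comp_const rmorph1 mulr1. Qed.

Lemma tau_comp_one_sub_tauK f : conv f -> f \oT one_sub_tau C \oT tau_geom = f.
Proof.
move=> f_conv; rewrite -tau_compA // -[RHS]tau_comp_const1; congr (_ \oT _).
by apply/funext => n; rewrite one_sub_tau_comp rmorph_nat tau_geom_sub.
Qed.

Lemma tau_comp_geomK f : conv f -> f \oT tau_geom \oT one_sub_tau C = f.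
Proof.
move=> f_conv; apply/funext => n; rewrite tau_comp_one_sub_tau.
pose shift_geom n := tau_geom (n - 1).
have shift_bounded : bounded_family v shift_geom.
  by have [c c_le] := tau_geom_bounded; exists c => m; apply: c_le.
have -> : (f \oT tau_geom) (n - 1) = (f \oT shift_geom) n.
  by congr (zsum v _); apply/funext => i; rewrite /shift_geom addrAC.
have -> : tau_geom = tau_const 1 \+ shift_geom.
  by apply/funext => m; rewrite /= -tau_geom_sub subrK.
by rewrite tau_compDr // tau_comp_const1 /= addrK.
Qed.

Lemma tau_comp_geom_compl f n : conv f -> eval f 1 = 0 ->
  (f \oT tau_geom) n = - (f \oT tau_indic (fun i => i < 0)) n.
Proof.
move=> f_conv f1; apply/eqP; rewrite -addr_eq0; apply/eqP.
have -> : (f \oT tau_geom) n + (f \oT tau_indic (fun i => i < 0)) n =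
    (f \oT (tau_geom \+ tau_indic (fun i => i < 0))) n.
  by rewrite tau_compDr.
have -> : tau_geom \+ tau_indic (fun i => i < 0) = cst 1.
  apply/funext => m; rewrite /= /tau_geom /tau_indic leNgt.
  by rewrite -natrD; case: (m < 0).
by rewrite tau_comp_cst f1.
Qed.

(* As f(1) = 0, the n-th coefficient is the sum of the f_i with i <= n and also
   minus the sum of those with n < i.  The former expression controls it for
   n -> -oo, the latter for n -> +oo. *)
Lemma tau_comp_geom_convergent f : conv f -> eval f 1 = 0 ->
  conv (f \oT tau_geom).
Proof.
move=> f_conv f1; apply/everywhere_convergentP => z eps eps_gt0.
have [c c_ge1 z_le] : exists2 c, 1 <= v c & v z <= v c.
  have [z_ge1|/ltW z_le1] := leP 1 (v z); first by exists z.
  by exists 1; rewrite (nonarch_abs1 v_abs).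
have fz_le i m n : m <= n -> v (f i * phi m z) <= v (f i * phi n c).
  by move=> mn; apply: nonarch_abs_le_mull => //; apply: frobz_abs_le_homo.
have /everywhere_convergentP/(_ c _ eps_gt0)[A A_tail] := f_conv.
have f_null := everywhere_convergent_null f_conv.
have [B B_tail] := null_familyZ v_abs c f_null eps_gt0.
have [N N_sub] := int_box_exhaust (A `|` B)%fset.
have tail i : i \notin int_box N N ->
    v (f i * phi i c) < eps /\ v (f i * c) < eps.
  move=> i_out; have : i \notin (A `|` B)%fset.
    by apply: contra i_out; apply/fsubsetP/N_sub.
  by rewrite inE negb_or (mulrC _ c) => /andP[/A_tail ? /B_tail].
exists (int_box N N) => n; rewrite mem_int_box => n_out.
have [n_ge0|n_lt0] := leP 0 n.
  rewrite tau_comp_geom_compl // mulNr (nonarch_absN v_abs).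
  apply: tau_comp_indic_lt => // i ni; have [|fi_lt _] := tail i.
    by rewrite mem_int_box; lia.
  by apply: le_lt_trans fi_lt; apply: fz_le; lia.
apply: tau_comp_indic_lt => // i ni; have [|_ fi_lt] := tail i.
  by rewrite mem_int_box; lia.
by apply: le_lt_trans fi_lt; rewrite -[c]frobz_id; apply: fz_le; lia.
Qed.

Lemma one_sub_tau_right_divisor f : conv f -> eval f 1 = 0 ->
  exists2 g, conv g & f = g \oT one_sub_tau C.
Proof.
move=> f_conv f1; exists (f \oT tau_geom); last by rewrite tau_comp_geomK.
exact: tau_comp_geom_convergent.
Qed.

Lemma tau_quotient_eq f alpha g : conv g ->
  f \oT tau_const alpha = g \oT one_sub_tau C -> tau_quotient v q f alpha = g.
Proof.
move=> g_conv fg; apply: xget_unique => // g' [g'_conv fg'].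
by rewrite -(tau_comp_one_sub_tauK g'_conv) -fg' fg tau_comp_one_sub_tauK.
Qed.

Lemma tau_eval_comp_const f a z : conv f ->
  eval (f \oT tau_const a) z = eval f (a * z).
Proof. by move=> f_conv; rewrite tau_eval_comp // tau_eval_const. Qed.

Lemma tau_quotientP f alpha : conv f -> ker f alpha ->
  conv (tau_quotient v q f alpha) /\
  f \oT tau_const alpha = tau_quotient v q f alpha \oT one_sub_tau C.
Proof.
move=> f_conv f_alpha.
have fa_conv := tau_comp_convergent f_conv (tau_const_convergent alpha).
have [|g g_conv fg] := one_sub_tau_right_divisor fa_conv.
  by rewrite tau_eval_comp_const // mulr1.
by rewrite (tau_quotient_eq g_conv fg).
Qed.

Lemma tau_quotient_comp_right f h alpha : conv f -> conv h -> ker f alpha ->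
  tau_quotient v q (h \oT f) alpha = h \oT tau_quotient v q f alpha.
Proof.
move=> f_conv h_conv /(tau_quotientP f_conv)[g_conv fg].
apply: tau_quotient_eq; first exact: tau_comp_convergent.
by rewrite -!tau_compA // fg.
Qed.

Lemma tau_quotient_comp_left f h alpha : conv f -> conv h ->
  ker (f \oT h) alpha ->
  exists2 k, conv k &
    tau_quotient v q (f \oT h) alpha =
    tau_quotient v q f (eval h alpha) \+ f \oT k.
Proof.
move=> f_conv h_conv fh_alpha.
have f_halpha : ker f (eval h alpha) by move: fh_alpha; rewrite tau_ker_comp.
have [g_conv fg] := tau_quotientP f_conv f_halpha.
set g := tau_quotient v q f (eval h alpha) in g_conv fg *.
pose d := (h \oT tau_const alpha) \+ tau_const (- eval h alpha).
have ha_conv := tau_comp_convergent h_conv (tau_const_convergent alpha).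
have d_conv : conv d by apply: everywhere_convergentD.
have [|k k_conv dk] := one_sub_tau_right_divisor d_conv.
  by rewrite tau_evalD // tau_eval_const tau_eval_comp_const // !mulr1 subrr.
have fk_conv := tau_comp_convergent f_conv k_conv.
exists k => //; apply: tau_quotient_eq; first exact: everywhere_convergentD.
have -> : f \oT h \oT tau_const alpha = f \oT (tau_const (eval h alpha) \+ d).
  rewrite -tau_compA //; congr (_ \oT _); apply/funext => n.
  by rewrite /d /tau_const /=; case: eqP => _; ring.
rewrite tau_compDr //; last exact: everywhere_convergent_bounded.
by rewrite fg dk tau_compDl // tau_compA.
Qed.

Lemma tau_pairing_comp_left f h alpha beta : conv f -> conv h ->
  ker (f \oT h) alpha -> ker (adj f) beta ->
  tau_pairing v q (f \oT h) alpha beta = tau_pairing v q f (eval h alpha) beta.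
Proof.
move=> f_conv h_conv fh_alpha f_beta.
have f_halpha : ker f (eval h alpha) by move: fh_alpha; rewrite tau_ker_comp.
have [g_conv _] := tau_quotientP f_conv f_halpha.
have [k k_conv quotE] := tau_quotient_comp_left f_conv h_conv fh_alpha.
have [adjf adjg adjk] : [/\ conv (adj f),
    conv (adj (tau_quotient v q f (eval h alpha))) & conv (adj k)].
  by split; apply: tau_adjoint_convergent.
rewrite /tau_pairing quotE tau_adjointD tau_adjoint_comp // tau_evalD //.
  by rewrite (tau_ker_comp_sub adjk adjf f_beta) addr0.
exact: tau_comp_convergent.
Qed.

Lemma tau_pairing_comp_right f h alpha beta : conv f -> conv h ->
  ker f alpha ->
  tau_pairing v q (h \oT f) alpha beta =
  tau_pairing v q f alpha (eval (adj h) beta).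
Proof.
move=> f_conv h_conv f_alpha; have [g_conv _] := tau_quotientP f_conv f_alpha.
rewrite /tau_pairing tau_quotient_comp_right // tau_adjoint_comp //.
by rewrite tau_eval_comp //; apply: tau_adjoint_convergent.
Qed.

End CompleteField.
End AbsoluteValue.
End PerfectField.

Lemma closed_field_root (C : closedFieldType) n (x : C) :
  (0 < n)%N -> exists y, y ^+ n = x.
Proof.
move=> n_gt0; have /closed_rootP[y] : size ('X^n - x%:P) != 1%N.
  by rewrite size_XnsubC // eqSS -lt0n.
by rewrite /root !hornerE subr_eq0 => /eqP <-; exists y.
Qed.

Theorem proposition8p7 (p e q : nat) (p_prime : prime p) (e_gt0 : (0 < e)%N)
    (q_def : q = (p ^ e)%N)
    (Fq : finFieldType) (card_Fq : #|Fq| = q)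
    (R : realType) (C : closedFieldType) (iota : {rmorphism Fq -> C})
    (v : C -> R) (v_abs : nonarch_abs v) (v_complete : abs_complete v)
    (f h : tau_series C)
    (f_conv : everywhere_convergent v q f) (f_neq0 : f <> (fun=> 0))
    (h_conv : everywhere_convergent v q h) (h_neq0 : h <> (fun=> 0)) :
  (tau_ker v q (tau_adjoint q f) `<=` tau_ker v q (tau_adjoint q (tau_comp v q f h)) /\
   forall alpha beta : C,
     tau_ker v q (tau_comp v q f h) alpha -> tau_ker v q (tau_adjoint q f) beta ->
     tau_pairing v q (tau_comp v q f h) alpha beta =
     tau_pairing v q f (tau_eval v q h alpha) beta) /\
  (tau_ker v q f `<=` tau_ker v q (tau_comp v q h f) /\
   forall alpha beta : C,
     tau_ker v q f alpha -> tau_ker v q (tau_adjoint q (tau_comp v q h f)) beta ->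
     tau_pairing v q (tau_comp v q h f) alpha beta =
     tau_pairing v q f alpha (tau_eval v q (tau_adjoint q h) beta)).
Proof.
have q_pchar : [pchar C].-nat q.
  rewrite q_def pnatX (eq_pnat _ (fmorph_pchar iota)) pnatE //.
  by rewrite (card_finPcharP (n := e)) // card_Fq.
have q_root (x : C) : exists y, y ^+ q = x.
  by apply: closed_field_root; rewrite q_def expn_gt0 prime_gt0.
split; split.
- exact: tau_ker_adjoint_comp_sub.
- by move=> alpha beta; apply: tau_pairing_comp_left.
- exact: tau_ker_comp_sub.
- by move=> alpha beta f_alpha _; apply: tau_pairing_comp_right.
Qed.
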